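(* Let $G$ be a finite group of nilpotency class $2$. Then for any group word $w$, $P(G,w)\geq\frac{1}{|G|}$.
   Context: A group word $w=w(x_1,\dots,x_n)$ in $n$ variables is an element of the free group $F_n$ on $x_1,\dots,x_n$; for a group $G$ and $\mathbf{g}=(g_1,\dots,g_n)\in G^{(n)}$ (the set of $n$-tuples of elements of $G$), $w(\mathbf{g})\in G$ is the element obtained by substituting $g_i$ for $x_i$. For a finite group $G$, $P(G,w)=\dfrac{|\{\mathbf{g}\in G^{(n)} : w(\mathbf{g})=1\}|}{|G|^n}$ is the probability that a random $n$-tuple of elements of $G$ satisfies $w$. *)

(* Defs.v *)
From HB Require Import structures.
From mathcomp Require Import all_boot all_order all_fingroup all_algebra all_solvable.

Set Implicit Arguments.
Unset Strict Implicit.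
Unset Printing Implicit Defensive.

Import GroupScope.

(* The free group F_n, realized by its normal forms: reduced words in the
   letters x_i = (i, false) and x_i^-1 = (i, true). *)

Definition letter (n : nat) := ('I_n * bool)%type.

Definition letter_inv n (a : letter n) : letter n := (a.1, ~~ a.2).

Definition reduced n (s : seq (letter n)) : bool :=
  sorted (fun a b => b != letter_inv a) s.

Record free_group (n : nat) :=
  FreeGroup { fg_word :> seq (letter n); _ : reduced fg_word }.

HB.instance Definition _ n := [isSub for @fg_word n].
HB.instance Definition _ n := [Choice of free_group n by <:].

(* The reduced form of a s, for s reduced. *)
Definition fg_push n (a : letter n) (s : seq (letter n)) : seq (letter n) :=
  if s is b :: s' then if b == letter_inv a then s' else a :: s else [:: a].

Section FreeGroup.
Variable n : nat.
Implicit Types (a b : letter n) (s t r : seq (letter n)) (u v w : free_group n).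

Lemma letter_invK : involutive (@letter_inv n).
Proof. by case=> i b; rewrite /letter_inv /= negbK. Qed.

Lemma reduced_behead a s : reduced (a :: s) -> reduced s.
Proof. exact: path_sorted. Qed.

Lemma reduced_push a s : reduced s -> reduced (fg_push a s).
Proof.
case: s => [|b s] //= rs; case: eqP => [_|/eqP nb]; first exact: path_sorted rs.
by rewrite /reduced /= nb.
Qed.

Lemma reduced_foldr s t : reduced t -> reduced (foldr (@fg_push n) t s).
Proof. by move=> rt; elim: s => //= a s; apply: reduced_push. Qed.

Lemma fg_push_cons a s : reduced (a :: s) -> fg_push a s = a :: s.
Proof. by case: s => //= b s /andP[/negPf->]. Qed.

Lemma fg_pushK a s : reduced s -> fg_push a (fg_push (letter_inv a) s) = s.
Proof.
case: s => [|b s] /=; first by rewrite eqxx.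
rewrite letter_invK; case: eqP => [->|_] rs; last by rewrite /= eqxx.
exact: fg_push_cons.
Qed.

Lemma foldr_fg_push a s t :
  reduced t -> foldr (@fg_push n) t (fg_push a s) = fg_push a (foldr (@fg_push n) t s).
Proof.
case: s => //= b s rt; case: eqP => [->|_] //.
by rewrite fg_pushK // reduced_foldr.
Qed.

Lemma foldr_foldr_fg_push s t r : reduced r ->
  foldr (@fg_push n) r (foldr (@fg_push n) t s)
  = foldr (@fg_push n) (foldr (@fg_push n) r t) s.
Proof. by move=> rr; elim: s => //= a s <-; rewrite foldr_fg_push. Qed.

Lemma foldr_fg_push_nil s : reduced s -> foldr (@fg_push n) [::] s = s.
Proof.
elim: s => //= a s IHs rs.
by rewrite IHs ?fg_push_cons //; apply: reduced_behead rs.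
Qed.

Lemma reduced_inv s : reduced s -> reduced (rev (map (@letter_inv n) s)).
Proof.
rewrite /reduced rev_sorted sorted_map; apply: sub_sorted => a b /=.
by rewrite /relpre /= letter_invK eq_sym.
Qed.

Lemma foldr_fg_push_inv s : reduced s ->
  foldr (@fg_push n) s (rev (map (@letter_inv n) s)) = [::].
Proof.
elim: s => //= a s IHs rs; rewrite rev_cons foldr_rcons /= letter_invK eqxx.
by apply: IHs; apply: reduced_behead rs.
Qed.

Definition fg_one := @FreeGroup n [::] isT.

Definition fg_inv u := FreeGroup (reduced_inv (valP u)).

Definition fg_mul u v := FreeGroup (reduced_foldr u (valP v)).

Lemma fg_mulA : associative fg_mul.
Proof.
by move=> u v w; apply: val_inj; rewrite /= foldr_foldr_fg_push // (valP w).
Qed.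

Lemma fg_mul1 : left_id fg_one fg_mul.
Proof. by move=> u; apply: val_inj. Qed.

Lemma fg_mulr1 : right_id fg_one fg_mul.
Proof. by move=> u; apply: val_inj; apply: foldr_fg_push_nil (valP u). Qed.

Lemma fg_mulV : left_inverse fg_one fg_inv fg_mul.
Proof. by move=> u; apply: val_inj; apply: foldr_fg_push_inv (valP u). Qed.

Lemma fg_invK : involutive fg_inv.
Proof.
by move=> u; apply: val_inj; rewrite /= map_rev revK (mapK letter_invK).
Qed.

Lemma fg_mulrV : right_inverse fg_one fg_inv fg_mul.
Proof. by move=> u; rewrite -{1}(fg_invK u) fg_mulV. Qed.

End FreeGroup.

HB.instance Definition _ n := isGroup.Build (free_group n)
  (@fg_mulA n) (@fg_mul1 n) (@fg_mulr1 n) (@fg_mulV n) (@fg_mulrV n).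

Definition fg_gen n (i : 'I_n) : free_group n :=
  @FreeGroup n [:: (i, false)] isT.

Definition letter_eval n (H : groupType) (g : 'I_n -> H) (a : letter n) : H :=
  if a.2 then (g a.1)^-1 else g a.1.

Definition word_eval n (H : groupType) (g : 'I_n -> H) (w : free_group n) : H :=
  \prod_(a <- w) letter_eval g a.

(* word_eval g is the unique group morphism F_n -> H mapping each x_i to g i. *)
Section WordEval.
Variables (n : nat) (H : groupType) (g : 'I_n -> H).

Lemma letter_eval_inv a : letter_eval g (letter_inv a) = (letter_eval g a)^-1.
Proof. by case: a => i []; rewrite /letter_eval /= ?invgK. Qed.

Lemma prod_fg_push a s :
  \prod_(b <- fg_push a s) letter_eval g b
  = letter_eval g a * \prod_(b <- s) letter_eval g b.
Proof.
case: s => [|b s] /=; first by rewrite big_cons.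
case: eqP => [->|_]; last by rewrite big_cons.
by rewrite big_cons letter_eval_inv mulVKg.
Qed.

Lemma word_evalM : {morph word_eval g : u v / u * v}.
Proof.
case=> s rs v; rewrite /word_eval /=; elim: s {rs} => [|a s IHs].
  by rewrite big_nil mul1g.
by rewrite /= prod_fg_push IHs big_cons mulgA.
Qed.

Lemma word_eval1 : word_eval g 1 = 1.
Proof. exact: big_nil. Qed.

HB.instance Definition _ := isUMagmaMorphism.Build (free_group n) H
  (word_eval g) (word_eval1, word_evalM).

Lemma word_eval_gen i : word_eval g (fg_gen i) = g i.
Proof. by rewrite /word_eval big_seq1. Qed.

Lemma word_eval_unique (f : {multiplicative free_group n -> H}) :
  (forall i, f (fg_gen i) = g i) -> f =1 word_eval g.
Proof.
move=> fg.
have f1 : f 1 = 1 by apply: (mulgI (f 1)); rewrite -gmulfM !mulg1.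
have fV u : f u^-1 = (f u)^-1.
  by apply: (mulgI (f u)); rewrite -gmulfM !mulgV.
case=> s; elim: s => [|a s IHs] rs.
  have -> : FreeGroup rs = 1 by apply: val_inj.
  by rewrite f1 word_eval1.
have rs' := reduced_behead rs.
pose x : free_group n := if a.2 then (fg_gen a.1)^-1 else fg_gen a.1.
have -> : FreeGroup rs = x * FreeGroup rs'.
  apply: val_inj; rewrite /x; case: a rs {x} => i [] rs /=;
    exact: esym (fg_push_cons rs).
rewrite gmulfM word_evalM IHs; congr (_ * _).
rewrite /x; case: a.2; last by rewrite fg word_eval_gen.
by rewrite fV fg [RHS]gmulfV /= word_eval_gen.
Qed.

End WordEval.

Definition word_sols (gT : finGroupType) (G : {set gT}) n (w : free_group n) :
    {set {ffun 'I_n -> gT}} :=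
  [set g : {ffun 'I_n -> gT} | (g \in ffun_on (mem G)) && (word_eval g w == 1)].

Definition word_prob (gT : finGroupType) (G : {set gT}) n (w : free_group n) :
    rat :=
  (#|word_sols G w|%:R / (#|G| ^ n)%:R)%R.

(* Main.v *)
Require Import Defs.
From HB Require Import structures.
From mathcomp Require Import all_boot all_order all_fingroup all_algebra all_solvable.
From mathcomp Require Import ring.

Set Implicit Arguments.
Unset Strict Implicit.
Unset Printing Implicit Defensive.

Import Num.Theory GRing.Theory.
Local Open Scope ring_scope.

(** Let [Z] be the center of [G]. Since commutators are central, they only
    depend on classes in the abelian group [V = G / Z], where they give an
    alternating biadditive form with values in [Z]; both groups are written
    additively below. Two words with the same exponent vector therefore
    differ on [G] by an integral quadratic form in the classes of the
    arguments ([quadratic_eq_exponents]).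

    Write the exponent vector of [w] as [k f] with [f] a row of a unimodular
    matrix, and let [p] be a word with exponent vector [f]. Then [w = p ^ k q]
    for a quadratic form [q], and it is enough to find [|G| ^ (n - 1)] solutions
    among the tuples for which [p] is central. Up to a unimodular change of
    variables, their classes are the tuples [u] of [V ^ (n - 1)], with [n - 1]
    further central parameters, and the value [y] of [p] runs freely over [Z];
    the equation becomes [k y + q u = 0].

    The heart of the proof is that an integral alternating form can be made
    tridiagonal by a unimodular change of basis ([parity_reduction]): move the
    coefficients of the pairs containing the first variable onto the second one,
    and repeat. So the even-indexed variables pair only with the odd-indexed
    ones, and for fixed odd-indexed variables [k y + q u] is a homomorphism to
    [Z] in [y] and the even-indexed ones. The kernel of a homomorphism to [Z]
    contains at least the proportion [1 / |Z|] of its source, which leaves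
    [|V| ^ (n - 1)] solutions [(u, y)] ([isotropic_split_count]), and
    [|V| ^ (n - 1) |Z| ^ (n - 1) = |G| ^ (n - 1)] solutions altogether
    ([word_solutions_count]). *)

(** * Unimodular reduction of integral alternating forms *)

Lemma row_reduction m (e : 'rV[int]_(1 + m)) :
  exists2 P, P \in unitmx & exists k : int, e *m P = row_mx k%:M (0 : 'rV_m).
Proof.
have [L _ [R uR [d _ ->]]] := int_Smith_normal_form e.
exists (invmx R); first by rewrite unitmx_inv.
rewrite mulmxK //; exists (L 0 0 * d`_0).
apply/rowP=> j; rewrite !mxE big_ord1 !mxE.
by case: splitP => i; rewrite ?ord1 => -> /=; rewrite !mxE ?mulr1n ?mulr0.
Qed.

(** The change of basis fixes the first coordinate, which is what makes the
    induction go through: once the first row is reduced to a single entry in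
    the second column, later steps no longer disturb it. The matrix obtained is
    tridiagonal, so its entries at indices of equal parity vanish. *)
Lemma parity_reduction_tail m (S : 'M[int]_(1 + m)) : S^T = - S ->
  exists2 U : 'M_m, U \in unitmx &
    let B : 'M_(1 + m) := block_mx 1%:M 0 0 U in
    forall i j : 'I_(1 + m), odd i = odd j -> (B^T *m S *m B) i j = 0.
Proof.
elim: m => [|m IHm] in S *; move=> skewS.
  have S0 i j : S i j = 0.
    have := congr1 (fun M : 'M_(1 + 0) => M i j) skewS.
    rewrite !mxE (ord1 i) (ord1 j) => /eqP; rewrite -addr_eq0 -mulr2n mulrn_eq0.
    by move/eqP.
  have -> : S = 0 by apply/matrixP=> i j; rewrite S0 mxE.
  by exists 1%:M; rewrite ?unitmx1 //= => i j _; rewrite mulmx0 mul0mx mxE.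
(* A change of the last variables that leaves one entry in the first row. *)
have [P uP [k rP]] := row_reduction (ursubmx S).
pose S' := P^T *m drsubmx S *m P.
have skewS' : S'^T = - S'.
  rewrite /S' !trmx_mul trmxK trmx_drsub skewS.
  have -> : drsubmx (- S) = - drsubmx S by apply/matrixP=> i j; rewrite !mxE.
  by rewrite mulNmx mulmxN mulmxA.
have [U uU parU] := IHm S' skewS'.
pose B : 'M_(1 + m) := block_mx 1%:M 0 0 U.
have uB : B \in unitmx by rewrite unitmxE /B det_ublock det1 mul1r -unitmxE.
exists (P *m B) => [|C]; first by rewrite unitmx_mul uP.
have rC : ursubmx S *m (P *m B) = row_mx k%:M 0.
  by rewrite mulmxA rP /B mul_row_block !mul0mx !mulmx0 mulmx1 !addr0.
have S00 : ulsubmx S = 0.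
  apply/matrixP=> i j; rewrite (ord1 i) (ord1 j).
  have := congr1 (fun M : 'M_(1 + m.+1) => M (lshift _ 0) (lshift _ 0)) skewS.
  rewrite !mxE => /eqP; rewrite -addr_eq0 -mulr2n mulrn_eq0 => /eqP.
  done.
have rS : dlsubmx S = - (ursubmx S)^T.
  by rewrite trmx_ursub skewS; apply/matrixP=> i j; rewrite !mxE opprK.
have -> : C^T *m S *m C =
    block_mx 0 (row_mx k%:M 0) (- (row_mx k%:M 0)^T) (B^T *m S' *m B).
  rewrite -[S]submxK S00 rS /C tr_block_mx !trmx0 trmx1 !mulmx_block.
  rewrite !(mul0mx, mulmx0, mul1mx, mulmx1, addr0, add0r) rC mulmxN.
  by rewrite -trmx_mul rC /S' trmx_mul !mulmxA.
have row0 (j : 'I_(1 + m)) : odd j -> row_mx k%:M (0 : 'rV_m) 0 j = 0.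
  by case: (split_ordP j) => j0 ->; rewrite ?row_mxEr ?mxE //= (ord1 j0).
move=> i j.
have [i' ->|i' ->] := split_ordP i; have [j' ->|j' ->] := split_ordP j.
- by rewrite block_mxEul mxE.
- rewrite block_mxEur (ord1 i') /= => odd_j.
  by apply: row0; rewrite -[odd _]negbK -odd_j.
- rewrite block_mxEdl (ord1 j') /= mxE mxE => odd_i.
  by apply/eqP; rewrite oppr_eq0 row0 //; rewrite -[odd _]negbK odd_i.
- by rewrite block_mxEdr => /negb_inj; apply: parU.
Qed.

(** The even-indexed and the odd-indexed new basis vectors span two isotropic
    sublattices. *)
Lemma parity_reduction m (S : 'M[int]_m) : S^T = - S ->
  exists2 U : 'M_m, U \in unitmx &
    forall i j : 'I_m, odd i = odd j -> (U^T *m S *m U) i j = 0.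
Proof.
case: m S => [|m] S skewS; first by exists 1%:M; rewrite ?unitmx1 // => -[].
have [U uU parU] := @parity_reduction_tail m S skewS.
exists (block_mx 1%:M 0 0 U : 'M_(1 + m)); last exact: parU.
by rewrite unitmxE (@det_ublock _ 1 m) det1 mul1r -unitmxE.
Qed.

(** * Quadratic forms with integral coefficients *)

Section MatrixAction.

Variable V : zmodType.

Definition mxact m n (Q : 'M[int]_(n, m)) (u : {ffun 'I_m -> V}) :
    {ffun 'I_n -> V} :=
  [ffun i => \sum_j u j *~ Q i j].

Lemma mxact_comp l m n (P : 'M_(l, n)) (Q : 'M_(n, m)) u :
  mxact P (mxact Q u) = mxact (P *m Q) u.
Proof.
apply/ffunP=> i; rewrite !ffunE.
under eq_bigr => j _ do rewrite ffunE mulrz_suml.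
rewrite exchange_big /=; apply: eq_bigr => j _.
rewrite mxE mulrz_sumr; apply: eq_bigr => h _.
by rewrite -mulrzA mulrC.
Qed.

Lemma mxact1 n u : mxact (1%:M : 'M_n) u = u.
Proof.
apply/ffunP=> i; rewrite ffunE (bigD1 i) //= big1 => [|j ne_ji].
  by rewrite mxE eqxx addr0.
by rewrite mxE eq_sym (negPf ne_ji) mulr0z.
Qed.

Lemma mxact0 m n u : mxact (0 : 'M_(n, m)) u = 0.
Proof.
by apply/ffunP=> i; rewrite !ffunE big1 // => j _; rewrite mxE mulr0z.
Qed.

Lemma mxactD m n (Q : 'M_(n, m)) u v : mxact Q (u + v) = mxact Q u + mxact Q v.
Proof.
apply/ffunP=> i; rewrite !ffunE -big_split /=; apply: eq_bigr => j _.
by rewrite ffunE mulrzDl.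
Qed.

End MatrixAction.

(** A substitute for counting the kernels of a family of homomorphisms. Think
    of [o] as the parameter of the family, of [h] as the homomorphisms, and of
    [tau x x'] as translating [x] by the part of [- x'] on which [h] is
    additive. Choose a reference point in each fiber of [(o, h)]: every [x] is
    recovered from [h x] and from its translate by the reference point of its
    own fiber, and this translate lies over [y0]. *)
Lemma fiber_count (X O Y : finType) (h : X -> Y) (o : X -> O) (y0 : Y)
    (tau : X -> X -> X) :
    (forall x x', o x = o x' -> h x = h x' ->
       o (tau x x') = o x /\ h (tau x x') = y0) ->
    (forall x1 x2 x', tau x1 x' = tau x2 x' -> x1 = x2) ->
  (#|X| <= #|[set x | h x == y0]| * #|Y|)%N.
Proof.
move=> tauP tau_inj.
pose ref x := odflt x [pick x' | (o x == o x') && (h x == h x')].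
have refP x : o x = o (ref x) /\ h x = h (ref x).
  by rewrite /ref; case: pickP => //= x' /andP[/eqP-> /eqP->].
have ref_eq x1 x2 : o x1 = o x2 -> h x1 = h x2 -> ref x1 = ref x2.
  move=> eo eh; rewrite /ref eo eh; case: pickP => //= /(_ x2).
  by rewrite !eqxx.
pose phi x := (tau x (ref x), h x).
have phi_inj : injective phi.
  move=> x1 x2 [etau eh]; have [o1 h1] := refP x1; have [o2 h2] := refP x2.
  have eo : o x1 = o x2.
    by rewrite -(proj1 (tauP _ _ o1 h1)) -(proj1 (tauP _ _ o2 h2)) etau.
  by apply: tau_inj (ref x2) _; rewrite -etau (ref_eq _ _ eo eh).
rewrite -(card_imset predT phi_inj) -(cardsT Y) -cardsX; apply: subset_leq_card.
apply/subsetP=> _ /imsetP[x _ ->]; have [o1 h1] := refP x.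
by rewrite !inE /= andbT (proj2 (tauP _ _ o1 h1)).
Qed.

Section Forms.

Variables (V W : finZmodType) (beta : V -> V -> W).

Hypothesis betaDl : forall x y z, beta (x + y) z = beta x z + beta y z.
Hypothesis betaDr : forall x y z, beta z (x + y) = beta z x + beta z y.
Hypothesis betaxx : forall x, beta x x = 0.

Definition qform n (A : 'M[int]_n) (v : {ffun 'I_n -> V}) : W :=
  \sum_i \sum_j beta (v i) (v j) *~ A i j.

Lemma betaC x y : beta y x = - beta x y.
Proof.
apply/eqP; rewrite -addr_eq0 addrC; apply/eqP.
by have := betaxx (x + y); rewrite betaDl !betaDr !betaxx add0r addr0.
Qed.

Lemma beta0l y : beta 0 y = 0.
Proof. by apply: (addrI (beta 0 y)); rewrite -betaDl !addr0. Qed.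

Lemma betaBl x y z : beta (x - y) z = beta x z - beta y z.
Proof. by rewrite -{2}(subrK y x) [in RHS]betaDl addrK. Qed.

Lemma betaNl x y : beta (- x) y = - beta x y.
Proof. by rewrite -[- x]add0r betaBl beta0l add0r. Qed.

Lemma betaMzl x y k : beta (x *~ k) y = beta x y *~ k.
Proof.
have nat_case i : beta (x *+ i) y = beta x y *+ i.
  by elim: i => [|i IHi]; rewrite ?beta0l // !mulrS betaDl IHi.
by case: k => i; rewrite ?NegzE ?mulrNz ?betaNl -!pmulrn nat_case.
Qed.

Lemma beta_suml I (r : seq I) (F : I -> V) y :
  beta (\sum_(i <- r) F i) y = \sum_(i <- r) beta (F i) y.
Proof.
by elim/big_rec2: _ => [|i z x _ <-]; rewrite ?beta0l ?betaDl.
Qed.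

Lemma betaMzr x y k : beta y (x *~ k) = beta y x *~ k.
Proof. by rewrite betaC betaMzl -mulNrz -betaC. Qed.

Lemma beta_sumr I (r : seq I) (F : I -> V) y :
  beta y (\sum_(i <- r) F i) = \sum_(i <- r) beta y (F i).
Proof.
by rewrite betaC beta_suml -sumrN; apply: eq_bigr => i _; rewrite -betaC.
Qed.

Lemma qformD n (A B : 'M_n) v : qform (A + B) v = qform A v + qform B v.
Proof.
rewrite /qform -big_split /=; apply: eq_bigr => i _.
by rewrite -big_split /=; apply: eq_bigr => j _; rewrite mxE mulrzDr.
Qed.

Lemma qformN n (A : 'M_n) v : qform (- A) v = - qform A v.
Proof.
rewrite /qform -sumrN; apply: eq_bigr => i _; rewrite -sumrN.
by apply: eq_bigr => j _; rewrite mxE mulrNz.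
Qed.

(** The form evaluated on two integral linear combinations of the [v i]: this
    is how the commutator of two words becomes a quadratic form. *)
Lemma qform_outer n (e f : 'rV[int]_n) (v : {ffun 'I_n -> V}) :
  beta (\sum_i v i *~ e 0 i) (\sum_i v i *~ f 0 i) = qform (e^T *m f) v.
Proof.
rewrite beta_suml; apply: eq_bigr => i _.
rewrite beta_sumr; apply: eq_bigr => j _.
by rewrite betaMzl betaMzr !mxE big_ord1 !mxE -mulrzA mulrC.
Qed.

Lemma qform_act m n (A : 'M_n) (Q : 'M_(n, m)) u :
  qform A (mxact Q u) = qform (Q^T *m A *m Q) u.
Proof.
pose F i j k l := beta (u k) (u l) *~ (Q i k * A i j * Q j l).
transitivity (\sum_i \sum_j \sum_k \sum_l F i j k l).
  apply: eq_bigr => i _; apply: eq_bigr => j _; rewrite !ffunE.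
  rewrite beta_suml mulrz_suml; apply: eq_bigr => k _.
  rewrite beta_sumr mulrz_suml; apply: eq_bigr => l _.
  by rewrite betaMzl betaMzr /F -!mulrzA; congr (_ *~ _); ring.
transitivity (\sum_k \sum_l \sum_j \sum_i F i j k l); last first.
  apply: eq_bigr => k _; apply: eq_bigr => l _.
  rewrite mxE mulrz_sumr; apply: eq_bigr => j _.
  rewrite mxE mulr_suml mulrz_sumr; apply: eq_bigr => i _.
  by rewrite mxE.
rewrite exchange_big /=.
under eq_bigr => j _ do rewrite exchange_big /=.
rewrite exchange_big /=; apply: eq_bigr => k _.
under eq_bigr => j _ do rewrite exchange_big /=.
by rewrite exchange_big.
Qed.

(** The terms at [(i, j)] and [(j, i)] cancel and the diagonal ones vanish. *)
Lemma qform_sym n (C : 'M_n) v : C^T = C -> qform C v = 0.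
Proof.
move=> symC; pose F (i j : 'I_n) := beta (v i) (v j) *~ C i j.
have FC i j : F j i = - F i j.
  have Cij : C j i = C i j.
    by have := congr1 (fun M : 'M_n => M i j) symC; rewrite mxE.
  by rewrite /F betaC Cij mulNrz.
rewrite /qform.
rewrite (eq_bigr (fun i : 'I_n =>
  \sum_(j < n | (i < j)%N) F i j + \sum_(j < n | (j < i)%N) F i j)); last first.
  move=> i _; rewrite (bigID (fun j : 'I_n => (i < j)%N)) /=; congr (_ + _).
  rewrite (bigD1 i) ?ltnn //= betaxx mul0rz add0r.
  by apply: eq_bigl => j; rewrite -leqNgt ltn_neqAle andbC.
rewrite big_split /= [X in _ + X](exchange_big_dep predT) //=.
rewrite -big_split big1 //= => i _; rewrite -big_split big1 //= => j _.
by rewrite (FC i j) subrr.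
Qed.

(** As [A - B] is symmetric when [A] and [B] have the same alternation. *)
Lemma qform_eq n (A B : 'M_n) v : A - A^T = B - B^T -> qform A v = qform B v.
Proof.
move=> eqAB; apply/eqP; rewrite -subr_eq0 -qformN -qformD qform_sym //.
rewrite raddfB /=; apply/eqP; rewrite -subr_eq0; apply/eqP.
have -> : A^T - B^T - (A - B) = (B - B^T) - (A - A^T).
  by apply/matrixP=> i j; rewrite !mxE; ring.
by rewrite eqAB subrr.
Qed.

(** With the odd-indexed coordinates fixed, the expression is additive in the
    even-indexed ones and in [c.2]; so each value of [W] is taken at most as
    often as [0]. *)
Lemma isotropic_split_count m (k : int) (A : 'M_m) :
    (forall i j : 'I_m, odd i = odd j -> (A - A^T) i j = 0) ->
  (#|V| ^ m <=
     #|[set c : {ffun 'I_m -> V} * W | (c.2 *~ k + qform A c.1 == 0)%R]|)%N.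
Proof.
move=> parA.
(* The same form, with only the (even, odd) coefficients left. *)
pose B := \matrix_(i < m, j < m)
  if ~~ odd i && odd j then (A - A^T) i j else 0.
have qAB v : qform A v = qform B v.
  apply: qform_eq; apply/matrixP=> i j; move: (parA i j); rewrite !mxE.
  by case: (odd i) (odd j) => [] [] /= => [->|_|_|->] //; ring.
have W_gt0 : (0 < #|W|)%N by apply/card_gt0P; exists 0%R.
rewrite -(leq_pmul2r W_gt0).
have -> : (#|V| ^ m * #|W| = #|{: {ffun 'I_m -> V} * W}|)%N.
  by rewrite card_prod card_ffun card_ord.
pose ev (u : {ffun 'I_m -> V}) := [ffun i : 'I_m => if odd i then 0 else u i].
pose od (u : {ffun 'I_m -> V}) := [ffun i : 'I_m => if odd i then u i else 0].
pose h (c : {ffun 'I_m -> V} * W) := c.2 *~ k + qform A c.1.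
(* Subtracting the even part of u' keeps the odd part of u. *)
apply: (@fiber_count _ _ _ h (fun c => od c.1) 0
  (fun c c' => (c.1 - ev c'.1, c.2 - c'.2))).
  move=> [u y] [u' y'] /= /ffunP eo eh; split.
    apply/ffunP=> i; rewrite !ffunE; case: (odd i) => //.
    by rewrite subr0.
  have -> : h (u - ev u', y - y') = h (u, y) - h (u', y').
    rewrite /h /= !qAB mulrzBl opprD addrACA; congr (_ + _).
    rewrite /qform -sumrB; apply: eq_bigr => i _.
    rewrite -sumrB; apply: eq_bigr => j _; rewrite !mxE.
    have := eo j; rewrite !ffunE.
    case: (odd i) => /=; first by rewrite !mulr0z subrr.
    case: (odd j) => /= [->|_]; last by rewrite !mulr0z subrr.
    by rewrite subr0 betaBl mulrzBl.
  by rewrite eh subrr.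
move=> [u1 y1] [u2 y2] [u y] /= [eu ey].
by rewrite (addIr _ eu) (addIr _ ey).
Qed.

End Forms.

(** * Abelian subgroups in additive notation *)

Section AdditiveCopy.

Variables (hT : finGroupType) (H : {group hT}) (cH : abelian H).

(** The commutativity proof is an argument so that the additive structure can
    be attached to the type canonically. *)
Definition additive_of of abelian H : predArgType := subg_of H.

Local Notation A := (additive_of cH).

HB.instance Definition _ := Finite.copy A (subg_of H).

Implicit Types x y z : A.

Definition to_add (x : hT) : A := subg H x.
Definition of_add (x : A) : hT := sgval x.

Definition add_zero : A := to_add 1%g.
Definition add_opp x : A := to_add (of_add x)^-1%g.
Definition add_add x y : A := to_add (of_add x * of_add y)%g.

Lemma of_addP x : of_add x \in H. Proof. exact: subgP. Qed.
Lemma of_addK : cancel of_add to_add. Proof. exact: sgvalK. Qed.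
Lemma to_addK : {in H, cancel to_add of_add}. Proof. exact: subgK. Qed.
Lemma of_add_inj : injective of_add. Proof. exact: can_inj of_addK. Qed.

Lemma add_addC : commutative add_add.
Proof.
by move=> x y; rewrite /add_add (centsP cH _ (of_addP x) _ (of_addP y)).
Qed.

Lemma add_addA : associative add_add.
Proof.
by move=> x y z; apply: of_add_inj; rewrite !to_addK ?groupM ?of_addP ?mulgA.
Qed.

Lemma add_add0 : left_id add_zero add_add.
Proof.
by move=> x; rewrite /add_add to_addK ?mul1g ?of_addK.
Qed.

Lemma add_addN : left_inverse add_zero add_opp add_add.
Proof.
by move=> x; rewrite /add_add to_addK ?groupV ?of_addP // mulVg.
Qed.

HB.instance Definition _ :=
  GRing.isZmodule.Build A add_addA add_addC add_add0 add_addN.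

Lemma of_add0 : of_add 0 = 1%g.
Proof. by rewrite to_addK. Qed.

Lemma of_addD x y : of_add (x + y) = (of_add x * of_add y)%g.
Proof. by rewrite to_addK ?groupM ?of_addP. Qed.

Lemma of_addN x : of_add (- x) = (of_add x)^-1%g.
Proof. by rewrite to_addK ?groupV ?of_addP. Qed.

Lemma of_addMn x i : of_add (x *+ i) = (of_add x ^+ i)%g.
Proof. by elim: i => [|i IHi]; rewrite ?of_add0 // mulrS of_addD IHi expgS. Qed.

Lemma card_additive_of : #|A| = #|H|.
Proof. by rewrite (card_sub (subg_of H)); apply: eq_card. Qed.

End AdditiveCopy.


(** * Exponent vectors of words *)

Section Words.

Variable n : nat.
Implicit Types (a : letter n) (s t : seq (letter n)).

(* Words are handled as arbitrary sequences of letters: evaluation in a group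
   makes sense without reducing them. *)

Definition word_inv s := rev (map (@letter_inv n) s).

Definition exponents s : 'rV[int]_n :=
  \row_i ((count_mem (i, false) s)%:Z - (count_mem (i, true) s)%:Z).

Lemma exponents_nil : exponents [::] = 0.
Proof. by apply/rowP=> i; rewrite !mxE subrr. Qed.

Lemma exponents_cat s t : exponents (s ++ t) = exponents s + exponents t.
Proof.
by apply/rowP=> i; rewrite !mxE !count_cat !PoszD opprD addrACA.
Qed.

Lemma exponents_inv s : exponents (word_inv s) = - exponents s.
Proof.
apply/rowP=> i; rewrite !mxE !count_rev !count_map opprB.
by congr (_%:Z - _%:Z); apply: eq_count => -[j []];
  rewrite /letter_inv /= !xpair_eqE.
Qed.

Definition word_pow s (k : int) :=
  match k with
  | Posz i => flatten (nseq i s)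
  | Negz i => flatten (nseq i.+1 (word_inv s))
  end.

Lemma exponents_pow s k : exponents (word_pow s k) = k *: exponents s.
Proof.
have exp_nat t i : exponents (flatten (nseq i t)) = exponents t *+ i.
  by elim: i => [|i IHi]; rewrite ?exponents_nil // mulrS exponents_cat IHi.
case: k => i; rewrite [LHS]exp_nat ?exponents_inv.
  by rewrite -scaler_nat natz.
by rewrite NegzE scaleNr mulNrn -scaler_nat natz.
Qed.

Lemma exponents_surj (f : 'rV[int]_n) : exists s, exponents s = f.
Proof.
rewrite [f]row_sum_delta; elim/big_rec: _ => [|i e _ [s <-]].
  by exists [::]; apply: exponents_nil.
exists (word_pow [:: (i, false)] (f 0 i) ++ s).
rewrite exponents_cat exponents_pow; congr (_ *: _ + _).
by apply/rowP=> j; rewrite !mxE /= !xpair_eqE /= andbT andbF subr0 addn0 eq_sym;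
  case: eqP.
Qed.

Definition exponent_sum (U : zmodType) (x : 'I_n -> U) s :=
  \sum_i x i *~ exponents s 0 i.

Lemma exponent_sum_nil (U : zmodType) (x : 'I_n -> U) : exponent_sum x [::] = 0.
Proof. by apply: big1 => i _; rewrite exponents_nil mxE mulr0z. Qed.

Lemma exponent_sum_cons (U : zmodType) (x : 'I_n -> U) a s :
  exponent_sum x (a :: s) = (if a.2 then - x a.1 else x a.1) + exponent_sum x s.
Proof.
rewrite /exponent_sum -cat1s exponents_cat.
under eq_bigr do rewrite mxE mulrzDr; rewrite big_split /=; congr (_ + _).
rewrite (bigD1 a.1) //= big1 => [|i ne_i].
  by rewrite addr0 mxE /=; case: a => i [] /=; rewrite !xpair_eqE eqxx /=
    ?andbT ?andbF /= ?addn0 ?sub0r ?subr0 ?mulrNz.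
by rewrite mxE /=; case: a ne_i => j b /= ne_i;
  rewrite !xpair_eqE eq_sym (negPf ne_i).
Qed.

Lemma exponents_count a s :
  exponents s = 0 -> count_mem (letter_inv a) s = count_mem a s.
Proof.
move=> /rowP/(_ a.1); rewrite !mxE => /eqP; rewrite subr_eq0 => /eqP[].
by case: a => i [] /= <-.
Qed.

End Words.

(** * Evaluation of words in a group of class two *)

Section ClassTwo.

Variables (gT : finGroupType) (G : {group gT}).
Hypothesis class2 : (G^`(1) \subset 'Z(G))%g.

Let abV : abelian (G / 'Z(G)) := sub_der1_abelian class2.
Local Notation V := (additive_of abV).
Local Notation W := (additive_of (center_abelian G)).

Definition center_class (x : gT) : V := to_add abV (coset 'Z(G) x).
Definition coset_lift (v : V) : gT := repr (of_add v).
Local Notation central := (to_add (center_abelian G)).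

Lemma in_norm_center x : x \in G -> x \in 'N('Z(G))%g.
Proof. exact/subsetP/normal_norm/center_normal. Qed.

Lemma center_sub_in x : x \in 'Z(G)%g -> x \in G.
Proof. exact/subsetP/center_sub. Qed.

Lemma center_comm z x : z \in 'Z(G)%g -> x \in G -> commute z x.
Proof. by case/centerP=> _; apply. Qed.

Lemma of_class x : x \in G -> of_add (center_class x) = coset 'Z(G) x.
Proof. by move=> Gx; rewrite to_addK ?mem_quotient. Qed.

Lemma center_classM :
  {in G &, {morph center_class : x y / (x * y)%g >-> x + y}}.
Proof.
move=> x y Gx Gy; apply: of_add_inj; rewrite of_addD !of_class ?groupM //.
by rewrite morphM ?in_norm_center.
Qed.

Lemma center_class_eq0 x : x \in G -> (center_class x == 0) = (x \in 'Z(G)%g).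
Proof.
move=> Gx; rewrite -(inj_eq (@of_add_inj _ _ _)) of_add0 of_class //.
apply/eqP/idP; last exact: coset_id.
by apply: coset_idr; apply: in_norm_center.
Qed.

Lemma center_classV x : x \in G -> center_class x^-1%g = - center_class x.
Proof.
move=> Gx; apply: of_add_inj; rewrite of_addN !of_class ?groupV //.
by rewrite morphV ?in_norm_center.
Qed.

Lemma coset_lift_in v : coset_lift v \in G.
Proof.
have /morphimP[x Nx Gx Ev] := of_addP v.
have : coset_lift v \in (coset 'Z(G) x : {set gT}).
  by rewrite /coset_lift Ev mem_repr_coset.
rewrite val_coset // => /rcosetP[z Zz ->].
by rewrite groupM // center_sub_in.
Qed.

Lemma coset_liftK : cancel coset_lift center_class.
Proof.
by move=> v; apply: of_add_inj; rewrite of_class ?coset_lift_in // coset_reprK.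
Qed.

Lemma comm_central x y : x \in G -> y \in G -> [~ x, y]%g \in 'Z(G)%g.
Proof. by move=> Gx Gy; apply: (subsetP class2); rewrite mem_commg. Qed.

Lemma commM x y z : x \in G -> y \in G -> z \in G ->
  [~ x * y, z]%g = ([~ x, z] * [~ y, z])%g.
Proof.
move=> Gx Gy Gz; rewrite commMgJ; congr (_ * _)%g.
by rewrite conjgE (center_comm (comm_central Gx Gz) Gy) mulKg.
Qed.

Lemma comm_eq_class x x' y : x \in G -> x' \in G -> y \in G ->
  center_class x = center_class x' -> [~ x, y]%g = [~ x', y]%g.
Proof.
move=> Gx Gx' Gy eqx.
have Zz : (x * x'^-1)%g \in 'Z(G)%g.
  by rewrite -center_class_eq0 ?groupM ?groupV // center_classM ?groupV //
    center_classV // eqx subrr.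
rewrite -[x in LHS](mulgKV x') commM ?groupM ?groupV //.
have /commgP/eqP-> := center_comm Zz Gy.
by rewrite mul1g.
Qed.

Definition comm_form (v v' : V) : W :=
  central [~ coset_lift v, coset_lift v']%g.

Lemma comm_formE x y : x \in G -> y \in G ->
  of_add (comm_form (center_class x) (center_class y)) = [~ x, y]%g.
Proof.
move=> Gx Gy; rewrite to_addK ?comm_central ?coset_lift_in //.
rewrite (@comm_eq_class (coset_lift _) x) ?coset_liftK ?coset_lift_in //.
rewrite -[LHS]invgK invg_comm.
by rewrite (@comm_eq_class (coset_lift _) y) ?coset_liftK ?coset_lift_in //
  invg_comm.
Qed.

Lemma comm_formDl u v w : comm_form (u + v) w = comm_form u w + comm_form v w.
Proof.
have Gl := coset_lift_in.
rewrite -(coset_liftK u) -(coset_liftK v) -(coset_liftK w).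
rewrite -center_classM //; apply: of_add_inj.
by rewrite of_addD !comm_formE ?groupM // commM.
Qed.

Lemma comm_formC v w : comm_form w v = - comm_form v w.
Proof.
have Gl := coset_lift_in; rewrite -(coset_liftK v) -(coset_liftK w).
apply: of_add_inj.
by rewrite of_addN !comm_formE // invg_comm.
Qed.

Lemma comm_formDr u v w : comm_form w (u + v) = comm_form w u + comm_form w v.
Proof. by rewrite comm_formC comm_formDl opprD -!comm_formC. Qed.

Lemma comm_formxx v : comm_form v v = 0.
Proof. by apply: of_add_inj; rewrite of_add0 to_addK commgg ?group1. Qed.

Local Notation q := (qform comm_form).

Section Evaluation.

Variable n : nat.
Implicit Types (a : letter n) (s t r : seq (letter n)) (g : {ffun 'I_n -> gT}).

Definition eval g s : gT := (\prod_(a <- s) letter_eval g a)%g.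

Definition center_classes g : {ffun 'I_n -> V} :=
  [ffun i => center_class (g i)].

Lemma eval_nil g : eval g [::] = 1%g. Proof. exact: big_nil. Qed.

Lemma eval_cons g a s : eval g (a :: s) = (letter_eval g a * eval g s)%g.
Proof. exact: big_cons. Qed.

Lemma eval_cat g s t : eval g (s ++ t) = (eval g s * eval g t)%g.
Proof. exact: big_cat. Qed.

Lemma eval_word_inv g s : eval g (word_inv s) = (eval g s)^-1%g.
Proof.
elim: s => [|a s IHs]; first by rewrite !eval_nil invg1.
rewrite /word_inv map_cons rev_cons -cats1 eval_cat IHs !eval_cons eval_nil.
by rewrite mulg1 letter_eval_inv invMg.
Qed.

Lemma eval_flatten g s i : eval g (flatten (nseq i s)) = (eval g s ^+ i)%g.
Proof.
by elim: i => [|i IHi]; rewrite ?eval_nil // [LHS]eval_cat IHi expgS.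
Qed.

Lemma eval_word_pow g s k (y : W) :
  eval g s = of_add y -> eval g (word_pow s k) = of_add (y *~ k).
Proof.
move=> Es; case: k => i; rewrite [LHS]eval_flatten ?eval_word_inv Es.
  by rewrite -of_addMn.
by rewrite NegzE mulrNz of_addN -pmulrn of_addMn expgVn.
Qed.

Lemma letter_in g a : (forall i, g i \in G) -> letter_eval g a \in G.
Proof. by move=> Gg; rewrite /letter_eval; case: a.2; rewrite ?groupV. Qed.

Lemma eval_in g s : (forall i, g i \in G) -> eval g s \in G.
Proof.
move=> Gg; elim: s => [|a s IHs]; first by rewrite eval_nil.
by rewrite eval_cons groupM // letter_in.
Qed.

Lemma center_class_eval g s : (forall i, g i \in G) ->
  center_class (eval g s) = exponent_sum (center_classes g) s.
Proof.
move=> Gg; elim: s => [|a s IHs].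
  by rewrite eval_nil exponent_sum_nil; apply/eqP; rewrite center_class_eq0.
rewrite eval_cons center_classM ?eval_in ?letter_in // IHs exponent_sum_cons.
congr (_ + _); rewrite ffunE /letter_eval.
by case: a.2 => //; apply: center_classV.
Qed.

(** Central factors can be collected on the right. *)
Lemma eval_shift g (z : 'I_n -> W) s : (forall i, g i \in G) ->
  eval [ffun i => (g i * of_add (z i))%g] s =
    (eval g s * of_add (exponent_sum z s))%g.
Proof.
move=> Gg; elim: s => [|a s IHs].
  by rewrite !eval_nil exponent_sum_nil of_add0 mulg1.
rewrite !eval_cons IHs exponent_sum_cons of_addD.
have Zz (w : W) x : x \in G -> commute (of_add w) x.
  by apply: center_comm; apply: of_addP.
have -> : letter_eval [ffun i => (g i * of_add (z i))%g] a =
    (letter_eval g a * of_add (if a.2 then - z a.1 else z a.1))%g.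
  rewrite /letter_eval ffunE; case: a.2 => //.
  by rewrite of_addN -Zz // invMg.
rewrite -!mulgA; congr (_ * _)%g; rewrite !mulgA; congr (_ * _)%g.
by rewrite Zz ?eval_in.
Qed.

(** Congruence of words modulo the weight-two part of a class two group. *)
Definition quadratic_eq s t := exists A : 'M_n, forall g,
  (forall i, g i \in G) ->
  eval g s = (eval g t * of_add (q A (center_classes g)))%g.

Lemma quadratic_eq_trans s t r :
  quadratic_eq s t -> quadratic_eq t r -> quadratic_eq s r.
Proof.
move=> [A EA] [B EB]; exists (B + A) => g Gg.
by rewrite EA // EB // qformD of_addD mulgA.
Qed.

Lemma quadratic_eq_swap s t r : quadratic_eq (s ++ t ++ r) (t ++ s ++ r).
Proof.
exists ((exponents s)^T *m exponents t) => g Gg.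
rewrite -(qform_outer comm_formDl comm_formDr comm_formxx).
rewrite -/(exponent_sum _ s) -/(exponent_sum _ t) -!center_class_eval //.
have Ge := eval_in _ Gg; rewrite comm_formE // !eval_cat mulgA.
have Zst := center_comm (comm_central (Ge s) (Ge t)) (Ge r).
by rewrite (commgC (eval g s)) -mulgA Zst !mulgA.
Qed.

(** If the exponents vanish, the inverse of the first letter occurs further on;
    swapping the first letter up to it costs a commutator and cancels both. *)
Lemma quadratic_eq_nil s : exponents s = 0 -> quadratic_eq s [::].
Proof.
have [m] := ubnP (size s); elim: m s => // m IHm [|a s] /=.
  move=> _ _; exists 0 => g _; rewrite eval_nil mul1g /qform big1 ?of_add0 //.
  by move=> i _; rewrite big1 // => j _; rewrite mxE mulr0z.
rewrite ltnS => lt_s exp0.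
have : letter_inv a \in s.
  have := exponents_count a exp0; rewrite /= eqxx.
  have -> : (a == letter_inv a) = false.
    by case: a {exp0} => i []; rewrite /letter_inv /= xpair_eqE andbF.
  by rewrite add0n add1n -has_pred1 has_count => ->.
move=> s_a'; case/splitPr: s_a' lt_s exp0 => s1 s2 lt_s exp0.
have eq1 : quadratic_eq (a :: s1 ++ letter_inv a :: s2) (s1 ++ s2).
  have [A EA] := quadratic_eq_swap [:: a] s1 (letter_inv a :: s2).
  exists A => g Gg; rewrite (EA g Gg) !eval_cat !eval_cons eval_nil mulg1.
  by rewrite letter_eval_inv mulKVg.
apply: quadratic_eq_trans eq1 _; apply: IHm.
  by apply: leq_trans lt_s; rewrite !size_cat ltnS leq_add2l /=.
move: exp0; rewrite -cat1s -[letter_inv a :: s2]cat1s !exponents_cat.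
have -> : [:: letter_inv a] = word_inv [:: a] by [].
by rewrite exponents_inv (addrCA (exponents s1)) addNKr.
Qed.

Lemma quadratic_eq_exponents s t :
  exponents s = exponents t -> quadratic_eq s t.
Proof.
move=> eq_st; have : exponents (word_inv t ++ s) = 0.
  by rewrite exponents_cat exponents_inv eq_st addNr.
case/quadratic_eq_nil => A EA; exists A => g Gg.
by rewrite -[LHS](mulKVg (eval g t)) -eval_word_inv -eval_cat
  EA // eval_nil mul1g.
Qed.

Lemma exponent_sum_mxact (U : zmodType) (v : {ffun 'I_n -> U}) s :
  exponent_sum v s = mxact (exponents s) v 0.
Proof. by rewrite ffunE. Qed.

End Evaluation.

(** An injective family of solutions is indexed by the zeros [(u, y)] of
    [isotropic_split_count] and by the tuples of [m] central elements. *)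
Lemma word_solutions_count m (s : seq (letter (1 + m))) :
  (#|G| ^ m <=
     #|[set g : {ffun 'I_(1 + m) -> gT} |
         (g \in ffun_on (mem G)) && (eval g s == 1%g)]|)%N.
Proof.
have [P uP [k eP]] := row_reduction (exponents s).
pose f := usubmx (invmx P); pose c := lsubmx P; pose Q0 := rsubmx P.
pose Q0' := dsubmx (invmx P).
have Es : exponents s = k *: f.
  rewrite -[LHS](mulmxK uP) eP -[invmx P]vsubmxK mul_row_col mul0mx addr0.
  by rewrite mul_scalar_mx.
have [fc fQ0 Q0K] : [/\ f *m c = 1%:M, f *m Q0 = 0 & Q0' *m Q0 = 1%:M].
  have := mulVmx uP; rewrite -[invmx P]vsubmxK -[P in _ *m P]hsubmxK.
  by rewrite mul_col_row scalar_mx_block => /eq_block_mx[].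
(* The word is p ^ k up to a quadratic form. *)
have [p Ep] := exponents_surj f.
have [A EA] : quadratic_eq s (word_pow p k).
  by apply: quadratic_eq_exponents; rewrite exponents_pow Ep.
have [|U uU parU] := @parity_reduction _ (Q0^T *m (A - A^T) *m Q0).
  by rewrite !trmx_mul trmxK raddfB /= trmxK mulmxA -mulNmx -mulmxN opprB.
(* The columns of Q are a basis of the kernel of f in which q splits. *)
pose Q := Q0 *m U.
have fQ : f *m Q = 0 by rewrite mulmxA fQ0 mul0mx.
have mxactQ_inj (T : zmodType) : injective (@mxact T _ _ Q).
  apply: (can_inj (g := mxact (invmx U *m Q0'))) => u.
  by rewrite mxact_comp -mulmxA (mulmxA Q0') Q0K mul1mx mulVmx // mxact1.
have parQ (i j : 'I_m) : odd i = odd j ->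
    (Q^T *m A *m Q - (Q^T *m A *m Q)^T) i j = 0.
  have -> : Q^T *m A *m Q - (Q^T *m A *m Q)^T
      = U^T *m (Q0^T *m (A - A^T) *m Q0) *m U.
    rewrite /Q !trmx_mul trmxK (mulmxBr Q0^T) (mulmxBl _ _ Q0) (mulmxBr U^T).
    by rewrite (mulmxBl _ _ U) trmxK !mulmxA.
  exact: parU.
have := isotropic_split_count comm_formDl comm_formDr comm_formxx k parQ.
set Z := [set _ | _] => le_Z.
(* The classes of [Phi d] are those of the lift [base] of [Q u]. The shift is
   chosen so that p takes the value y at [Phi d]: as f c = 1 and f Q = 0, its
   first term corrects the value at [base] and its second is free. *)
pose base (u : {ffun 'I_m -> V}) := [ffun i => coset_lift (mxact Q u i)].
pose shift (d : ({ffun 'I_m -> V} * W) * {ffun 'I_m -> W}) :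
    {ffun 'I_(1 + m) -> W} :=
  mxact c [ffun _ => d.1.2 - central (eval (base d.1.1) p)] + mxact Q d.2.
pose Phi d : {ffun 'I_(1 + m) -> gT} :=
  [ffun i => (base d.1.1 i * of_add (shift d i))%g].
have Gbase u i : base u i \in G by rewrite ffunE coset_lift_in.
have GPhi d i : Phi d i \in G.
  by rewrite ffunE groupM // center_sub_in // of_addP.
have class_base u : center_classes (base u) = mxact Q u.
  by apply/ffunP=> i; rewrite 2!ffunE coset_liftK.
have class_Phi d : center_classes (Phi d) = mxact Q d.1.1.
  rewrite -class_base; apply/ffunP=> i; rewrite ffunE [in RHS]ffunE ffunE.
  have Zz := of_addP (shift d i); have Gz := center_sub_in Zz.
  have /eqP z0 : center_class (of_add (shift d i)) == 0.
    by rewrite center_class_eq0.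
  by rewrite center_classM // z0 addr0 ffunE.
have base_p u : eval (base u) p \in 'Z(G)%g.
  rewrite -center_class_eq0 ?eval_in // center_class_eval // exponent_sum_mxact.
  by rewrite class_base mxact_comp Ep fQ mxact0 ffunE.
have Phi_p d : eval (Phi d) p = of_add d.1.2.
  rewrite eval_shift // exponent_sum_mxact mxactD !mxact_comp Ep fc fQ.
  rewrite mxact1 mxact0 addr0 ffunE.
  rewrite -[X in (X * _)%g](to_addK (center_abelian G)) //.
  by rewrite -of_addD addrC subrK.
have Phi_s d : d.1 \in Z -> eval (Phi d) s = 1%g.
  rewrite inE => /eqP Zd; rewrite EA // (eval_word_pow _ (Phi_p d)) -of_addD.
  rewrite class_Phi (qform_act comm_formDl comm_formDr comm_formxx).
  by rewrite Zd of_add0.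
have Phi_inj : injective Phi.
  move=> [[u y] z] [[u' y'] z'] eqPhi.
  have Eu : u = u'.
    apply: mxactQ_inj; have := congr1 (@center_classes _) eqPhi.
    by rewrite !class_Phi.
  have Ey : y = y'.
    apply: of_add_inj; have := congr1 (fun g => eval g p) eqPhi.
    by rewrite /= !Phi_p.
  rewrite -{}Eu -{}Ey in eqPhi *; congr (_, _); apply: mxactQ_inj.
  apply: (addrI (mxact c [ffun _ => y - central (eval (base u) p)])).
  apply/ffunP=> i; apply: of_add_inj; apply: (mulgI (base u i)).
  by have /ffunP/(_ i) := eqPhi; rewrite !ffunE.
have -> : (#|G| = #|V| * #|W|)%N.
  rewrite !card_additive_of card_quotient ?normal_norm ?center_normal //.
  by rewrite mulnC Lagrange ?center_sub.
rewrite expnMn.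
have -> : (#|W| ^ m = #|[set: {ffun 'I_m -> W}]|)%N.
  by rewrite cardsT card_ffun card_ord.
apply: leq_trans (leq_mul le_Z (leqnn _)) _.
rewrite -cardsX -(card_imset _ Phi_inj); apply: subset_leq_card.
apply/subsetP=> g /imsetP[[b z] /setXP[Zb _] ->].
rewrite inE Phi_s // eqxx andbT.
by apply/ffun_onP.
Qed.

End ClassTwo.

Theorem theorem1p1 (gT : finGroupType) (G : {group gT})
    (hnil : nilpotent G) (hclass : nil_class G = 2%N)
    (n : nat) (w : free_group n) :
  (1 / #|G|%:R <= word_prob G w)%R.
Proof.
have class2 : (G^`(1) \subset 'Z(G))%g by rewrite -nil_class2 hclass.
have G_gt0 i : 0 < (#|G| ^ i)%:R :> rat by rewrite ltr0n expn_gt0 cardG_gt0.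
have G1 : 0 < #|G|%:R :> rat by rewrite -[#|G|]expn1.
case: n w => [|m] w.
  have -> : word_prob G w = 1.
    rewrite /word_prob divr1.
    have -> : word_sols G w = setT.
      apply/setP=> g; rewrite !inE; apply/andP; split.
        by apply/ffun_onP=> -[].
      by case: w => -[|[[]]//] ?; rewrite /word_eval big_nil.
    by rewrite cardsT card_ffun card_ord.
  by rewrite ler_pdivrMr // mul1r ler1n cardG_gt0.
have := @word_solutions_count _ _ class2 m (fg_word w).
rewrite -(ler_nat rat) => le_count.
rewrite /word_prob ler_pdivlMr // expnS natrM div1r mulKf ?lt0r_neq0 //.
Qed.
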